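(* Let $S_1,S_2$ be nonempty subsets of $I=\{1,\dots,m\}$. For $a=1,2$, let $(x^a,\lambda^a,u^a)$ be an extremal defined on a time interval $[0,T_a]$ ($T_a>0$) which is $u_i$-singular for all $i\in S_a$. Assume $x^1(T_1)=x^2(0)$. Suppose that for $a=1,2$ there exists a sequence of nonempty sets $J_s^a\subseteq J_{s-1}^a\subseteq\cdots\subseteq J_1^a\subseteq J_0^a=S_a$ such that: 1. along $(x^a,\lambda^a,u^a)$, for every $1\le l\le s$, every $j\in J_l^a$ and every $k\in I$: $[g_k,\mathrm{ad}_f^{\,l-1}g_j]\in\mathrm{Span}\{\mathrm{ad}_f^{\,w}g_v:\ w=0,\dots,l-1,\ v\in J_w^a\}$; 2. at the junction point $x^1(T_1)=x^2(0)$: $\mathrm{Span}\{\mathrm{ad}_f^{\,w}g_v:\ w=0,\dots,s,\ v\in J_w^1\cup J_w^2\}=\mathbb{R}^n$. Then the concatenation $(x,\lambda,u)$ on $[0,T_1+T_2]$ given by $$(x(t),\lambda(t),u(t))=\begin{cases}(x^1(t),\lambda^1(t),u^1(t)), & t\in[0,T_1],\\ (x^2(t-T_1),\lambda^2(t-T_1),u^2(t-T_1)), & t\in[T_1,T_1+T_2],\end{cases}$$ is not an extremal.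
   Context: Setting: $f,g_1,\dots,g_m$ are smooth vector fields on $\mathbb{R}^n$, with $g_1(x),\dots,g_m(x)$ linearly independent for every $x$. Fix constants $\alpha_i<0<\beta_i$ and let $\mathcal{U}=\{u\in\mathbb{R}^m:\alpha_i\le u_i\le\beta_i,\ i=1,\dots,m\}$. An admissible control is a measurable function $u:[0,T]\to\mathbb{R}^m$ with $u(t)\in\mathcal{U}$ for a.e. $t$. The control system is $\dot x(t)=f(x(t))+\sum_{i=1}^m g_i(x(t))u_i(t)$. Lie bracket: $[X,Y](x)=DY(x)X(x)-DX(x)Y(x)$; $\mathrm{ad}_f^0g=g$, $\mathrm{ad}_f^{s+1}g=[f,\mathrm{ad}_f^sg]$. Spans are real linear spans of values at a point; ''along an extremal'' means at every point $x(t)$ of it. Hamiltonian: $H(\lambda,x,u)=\lambda^tf(x)+\sum_{i=1}^m\lambda^tg_i(x)u_i$. An extremal on $[0,T]$ is a triple $(x,\lambda,u)$, with $u$ an admissible control and $x,\lambda:[0,T]\to\mathbb{R}^n$ absolutely continuous, $\lambda(t)\ne0$ for all $t$, such that for a.e. $t$: $\dot x=\partial H/\partial\lambda$, $\dot\lambda=-\partial H/\partial x$, $H(\lambda(t),x(t),u(t))=\max_{v\in\mathcal{U}}H(\lambda(t),x(t),v)$, and $H(\lambda(t),x(t),u(t))=\lambda_0$ for a constant $\lambda_0\ge0$. (If the two values $\lambda^1(T_1)$ and $\lambda^2(0)$ differ, the concatenated $\lambda$ is not continuous and hence the triple is not an extremal.) The extremal is $u_i$-singular if $\phi_i(t)=\lambda^t(t)g_i(x(t))$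 vanishes identically on its interval of definition. *)

(* Defs.v *)
From HB Require Import structures.
From mathcomp Require Import all_boot all_order all_algebra.
From mathcomp Require Import all_classical all_reals all_analysis.

Set Implicit Arguments.
Unset Strict Implicit.
Unset Printing Implicit Defensive.

Import Order.TTheory GRing.Theory Num.Theory.
Import numFieldNormedType.Exports.

Local Open Scope classical_set_scope.
Local Open Scope ring_scope.

(* Vectors of R^n are row vectors, so that lambda^t y is [dot lambda y]. A    *)
(* curve on [0, T] is a total function on R, whose values outside [0, T] are  *)
(* never used: a derivative at almost every t in [0, T] only concerns         *)
(* interior points.                                                           *)

Definition dot (R : realType) (n : nat) (p q : 'rV[R]_n) : R :=
  (p *m q^T) 0 0.

(* When V is finite dimensional, as it is below, this is the usual class C^k. *)
Fixpoint Ck (R : realType) (V W : normedModType R) (k : nat) (F : V -> W)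
    : Prop :=
  if k is k'.+1 then
    (forall x, differentiable F x) /\ (forall v, Ck k' (fun x => 'D_v F x))
  else continuous F.

Definition smooth (R : realType) (n : nat) (X : 'rV[R]_n -> 'rV[R]_n) : Prop :=
  forall k, Ck k X.

Definition lie_bracket (R : realType) (n : nat) (X Y : 'rV[R]_n -> 'rV[R]_n)
    : 'rV[R]_n -> 'rV[R]_n :=
  fun x => 'd Y x (X x) - 'd X x (Y x).

Definition ad (R : realType) (n : nat) (f : 'rV[R]_n -> 'rV[R]_n) (s : nat)
    (X : 'rV[R]_n -> 'rV[R]_n) : 'rV[R]_n -> 'rV[R]_n :=
  iter s (lie_bracket f) X.

(* Span { ad_f^w g_v (x) : w = 0, ..., l - 1, v \in J w } *)
Definition ad_span (R : realType) (n m : nat) (f : 'rV[R]_n -> 'rV[R]_n)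
    (g : 'I_m -> 'rV[R]_n -> 'rV[R]_n) (J : nat -> {set 'I_m}) (l : nat)
    (x : 'rV[R]_n) : {vspace 'rV[R]_n} :=
  <<[seq ad f w (g v) x | w <- iota 0 l, v <- enum (J w)]>>%VS.

Definition gradient (R : realType) (n : nat) (h : 'rV[R]_n -> R)
    (p : 'rV[R]_n) : 'rV[R]_n :=
  \row_i 'D_(delta_mx 0 i) h p.

(* The open intervals ]a k, b k[ are pairwise disjoint subintervals of        *)
(* [c, d]; the degenerate ones are empty and contribute nothing.              *)
Definition absolutely_continuous (R : realType) (V : normedModType R)
    (c d : R) (F : R -> V) : Prop :=
  forall e : R, 0 < e -> exists2 delta : R, 0 < delta &
    forall (N : nat) (a b : 'I_N -> R),
      (forall k, [/\ c <= a k, a k <= b k & b k <= d]) ->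
      trivIset setT (fun k => `]a k, b k[%classic) ->
      \sum_k (b k - a k) < delta ->
      \sum_k `|F (b k) - F (a k)| < e.

(* The domain carries the completed (Caratheodory) sigma-algebra and not just *)
(* the Borel one.                                                             *)
Definition lebesgue_measurable_fun (R : realType) (D : set R) (h : R -> R)
    : Prop :=
  @measurable_fun _ _ (caratheodory_type (@wlength R idfun)^*%mu)
    (measurableTypeR R) D h.

Definition control_set (R : realType) (m : nat) (alpha beta : 'I_m -> R)
    : set 'rV[R]_m :=
  [set v | forall i, alpha i <= v 0 i <= beta i].

Definition admissible (R : realType) (m : nat) (alpha beta : 'I_m -> R)
    (T : R) (u : R -> 'rV[R]_m) : Prop :=
  (forall i, lebesgue_measurable_fun `[0, T] (fun t => u t 0 i)) /\
  {ae lebesgue_measure, forall t : R,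
    t \in `[0, T] -> control_set alpha beta (u t)}.

Definition hamiltonian (R : realType) (n m : nat) (f : 'rV[R]_n -> 'rV[R]_n)
    (g : 'I_m -> 'rV[R]_n -> 'rV[R]_n)
    (lam x : 'rV[R]_n) (u : 'rV[R]_m) : R :=
  dot lam (f x) + \sum_i dot lam (g i x) * u 0 i.

Definition is_maximum (R : realType) (A : set R) (M : R) : Prop :=
  A M /\ ubound A M.

Definition extremal (R : realType) (n m : nat) (f : 'rV[R]_n -> 'rV[R]_n)
    (g : 'I_m -> 'rV[R]_n -> 'rV[R]_n) (alpha beta : 'I_m -> R) (T : R)
    (x lam : R -> 'rV[R]_n) (u : R -> 'rV[R]_m) : Prop :=
  let H := hamiltonian f g in
  [/\ admissible alpha beta T u,
      absolutely_continuous 0 T x,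
      absolutely_continuous 0 T lam,
      (forall t : R, t \in `[0, T] -> lam t != 0) &
      exists2 lam0 : R, 0 <= lam0 &
        {ae lebesgue_measure, forall t : R, t \in `[0, T] ->
          [/\ is_derive t 1 x (gradient (fun p => H p (x t) (u t)) (lam t)),
              is_derive t 1 lam
                (- gradient (fun q => H (lam t) q (u t)) (x t)),
              is_maximum [set H (lam t) (x t) v | v in control_set alpha beta]
                (H (lam t) (x t) (u t)) &
              H (lam t) (x t) (u t) = lam0]}].

Definition singular (R : realType) (n m : nat)
    (g : 'I_m -> 'rV[R]_n -> 'rV[R]_n) (T : R) (x lam : R -> 'rV[R]_n)
    (i : 'I_m) : Prop :=
  forall t : R, t \in `[0, T] -> dot (lam t) (g i (x t)) = 0.

Definition nested_from (m s : nat) (S : {set 'I_m}) (J : nat -> {set 'I_m})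
    : Prop :=
  [/\ J 0%N = S,
      (forall l : nat, (l < s)%N -> J l.+1 \subset J l) &
      (forall l : nat, (l <= s)%N -> J l != finset.set0)].

Definition bracket_condition (R : realType) (n m : nat)
    (f : 'rV[R]_n -> 'rV[R]_n) (g : 'I_m -> 'rV[R]_n -> 'rV[R]_n)
    (s : nat) (J : nat -> {set 'I_m}) (T : R) (x : R -> 'rV[R]_n) : Prop :=
  forall t : R, t \in `[0, T] ->
  forall l : nat, (1 <= l <= s)%N -> forall j k : 'I_m, j \in J l ->
    lie_bracket (g k) (ad f l.-1 (g j)) (x t) \in ad_span f g J l (x t).

(* The two pieces may disagree at the junction time T1; its value is taken    *)
(* from the first one.                                                        *)
Definition concatenation (R : realType) (A : Type) (T1 : R) (p q : R -> A)
    : R -> A :=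
  fun t => if t <= T1 then p t else q (t - T1).

(* Main.v *)
Require Import Defs.
From HB Require Import structures.
From mathcomp Require Import all_boot all_order all_algebra lra.
From mathcomp Require Import all_classical all_reals all_analysis.

Set Implicit Arguments.
Unset Strict Implicit.
Unset Printing Implicit Defensive.

Import Order.TTheory GRing.Theory Num.Theory.
Import numFieldNormedType.Exports.

Local Open Scope classical_set_scope.
Local Open Scope ring_scope.

(** Along a [u_i]-singular arc the costate is orthogonal to [g_i]. For a smooth
    field [Y], the state and adjoint equations give, at almost every time,
    [(lam . Y)' = lam . [f, Y] + sum_k u_k (lam . [g_k, Y])]
    ([derive_dot_field] and [lie_bracket_controlled_field]). Feeding the
    identities [lam . ad_f^l g_j = 0] back into this formula, the bracket
    condition kills the terms that contain the control, and the next identity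
    [lam . ad_f^(l+1) g_j = 0] follows, first almost everywhere and then, by
    continuity, at every time including the end points
    ([ae_zero_continuous]). Thus the costate of each arc annihilates all
    [ad_f^w g_v] with [w <= s] and [v] in its own [J w]
    ([singular_arc_annihilates_ad]).

    If the concatenation were an extremal, its costate would be absolutely
    continuous, so the two costates would agree at the junction
    ([absolutely_continuous_concatenation]). Their common value would then
    annihilate the fields of both families at the junction point. These span
    the whole space, so the costate would be zero there, which an extremal
    excludes.

    The formula for the derivative requires [ad_f^w g_v] to be differentiable
    and continuous; for this the class of smooth fields is shown to be stable
    under Lie brackets. *)

(** * Differentiation of bilinear expressions *)

Section Bilinear.
Context {R : realType} {V U U' W : normedModType R}.
Variable B : {bilinear U -> U' -> W}.
Hypothesis B_continuous : continuous (fun p => B p.1 p.2).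
Implicit Types (F : V -> U) (G : V -> U').

Lemma differentiable_bilinear F G x :
  differentiable F x -> differentiable G x ->
  differentiable (fun y => B (F y) (G y)) x.
Proof.
move=> dF dG; apply: (@differentiable_comp _ _ _ _ (fun y => (F y, G y))
  (fun p => B p.1 p.2)).
- exact: differentiable_pair.
- exact: differentiable_bilin.
Qed.

Lemma derive_bilinear F G x v :
  differentiable F x -> differentiable G x ->
  'D_v (fun y => B (F y) (G y)) x = B (F x) ('D_v G x) + B ('D_v F x) (G x).
Proof.
move=> dF dG; rewrite deriveE; last exact: differentiable_bilinear.
have dFG := differentiable_pair dF dG.
rewrite (@diff_comp _ _ _ _ (fun y => (F y, G y)) (fun p => B p.1 p.2)) //=;
  last exact: differentiable_bilin.
by rewrite diff_bilin // diff_pair // !deriveE.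
Qed.

End Bilinear.

(** * Smooth maps are closed under Lie brackets *)

Section Smoothness.
Context {R : realType}.
Implicit Types V W : normedModType R.

Lemma Ck_pred V W k (F : V -> W) : Ck k.+1 F -> Ck k F.
Proof.
elim: k F => [|k IHk] F [dF DF].
  by move=> x; apply: differentiable_continuous; exact: dF.
by split=> // v; exact: IHk.
Qed.

Lemma Ck_cst V W k (c : W) : Ck k (fun _ : V => c).
Proof.
elim: k c => [|k IHk] c; first by move=> x; exact: cvg_cst.
split=> [x|v]; first exact: differentiable_cst.
by under eq_fun do rewrite derive_cst; exact: IHk.
Qed.

Lemma Ck_add V W k (F G : V -> W) :
  Ck k F -> Ck k G -> Ck k (fun x => F x + G x).
Proof.
elim: k F G => [|k IHk] F G; first by move=> cF cG x;
  apply: cvgD; [exact: cF|exact: cG].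
move=> [dF DF] [dG DG]; split=> [x|v].
  exact: differentiableD.
rewrite (_ : (fun _ => _) = fun x => 'D_v F x + 'D_v G x).
  by apply: IHk; [exact: DF|exact: DG].
by apply/funext => x; apply: deriveD; exact: diff_derivable.
Qed.

Lemma Ck_sum V W k (I : Type) (r : seq I) (F : I -> V -> W) :
  (forall i, Ck k (F i)) -> Ck k (fun x => \sum_(i <- r) F i x).
Proof.
move=> CF; elim: r => [|i r IHr].
  by under eq_fun do rewrite big_nil; exact: Ck_cst.
by under eq_fun do rewrite big_cons; exact: Ck_add.
Qed.

(** By the product rule each directional derivative of [B F G] is a sum of two
    expressions of the same shape, so the induction on the order only needs to
    be general in [F] and [G]. *)
Lemma Ck_bilinear V (U U' W : normedModType R) (B : {bilinear U -> U' -> W})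
    k (F : V -> U) (G : V -> U') :
  continuous (fun p => B p.1 p.2) -> Ck k F -> Ck k G ->
  Ck k (fun x => B (F x) (G x)).
Proof.
move=> cB; elim: k F G => [|k IHk] F G.
  move=> cF cG x.
  apply: (@continuous2_cvg _ _ _ _ _ _ F G B). 
  - exact: (cB (F x, G x)).
  - exact: cF.
  - exact: cG.
move=> CF CG; have [dF DF] := CF; have [dG DG] := CG.
split=> [x|v]; first exact: differentiable_bilinear.
rewrite (_ : (fun _ => _) = fun x => B (F x) ('D_v G x) + B ('D_v F x) (G x)).
  apply: Ck_add; apply: IHk;
    [exact: Ck_pred|exact: DG|exact: DF|exact: Ck_pred].
by apply/funext => x; exact: derive_bilinear.
Qed.

Lemma Ck_linear V W (W' : normedModType R) (L : {linear W -> W'}) k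
    (F : V -> W) :
  continuous L -> Ck k F -> Ck k (fun x => L (F x)).
Proof.
move=> cL; elim: k F => [|k IHk] F.
  by move=> cF x; apply: cvg_comp; [exact: cF|exact: cL].
move=> [dF DF]; have dL y := @linear_differentiable _ _ _ L y cL.
split=> [x|v]; first exact: (@differentiable_comp _ _ _ _ F L).
rewrite (_ : (fun _ => _) = fun x => L ('D_v F x)).
  by apply: IHk; exact: DF.
apply/funext => x.
rewrite deriveE; last exact: (@differentiable_comp _ _ _ _ F L).
by rewrite (@diff_comp _ _ _ _ F L) //= diff_lin // deriveE.
Qed.

End Smoothness.

Section VectorFields.
Context {R : realType} {n : nat}.
Implicit Types (X Y : 'rV[R]_n -> 'rV[R]_n).

Lemma scale_is_bilinear : bilinear_for
    (GRing.Scale.Law.clone _ _ *:%R _) (GRing.Scale.Law.clone _ _ *:%R _)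
    (@GRing.scale R 'rV[R]_n : R -> 'rV[R]_n -> 'rV[R]_n).
Proof.
split=> [u'|u] a x y /=.
- by rewrite scalerDl scalerA.
- by rewrite scalerDr !scalerA mulrC.
Qed.
HB.instance Definition _ := bilinear_isBilinear.Build R R 'rV[R]_n 'rV[R]_n _ _
  (@GRing.scale R 'rV[R]_n : R -> 'rV[R]_n -> 'rV[R]_n) scale_is_bilinear.

Lemma dot_is_bilinear : bilinear_for
    (GRing.Scale.Law.clone _ _ *:%R _) (GRing.Scale.Law.clone _ _ *:%R _)
    (@dot R n : 'rV[R]_n -> 'rV[R]_n -> R).
Proof.
split=> [u'|u] a x y /=; rewrite /dot.
- by rewrite mulmxDl -scalemxAl !mxE.
- by rewrite linearP mulmxDr -scalemxAr !mxE.
Qed.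
HB.instance Definition _ := bilinear_isBilinear.Build R 'rV[R]_n 'rV[R]_n R _ _
  (@dot R n) dot_is_bilinear.

Lemma dotE (p q : 'rV[R]_n) : dot p q = \sum_i p 0 i * q 0 i.
Proof. by rewrite /dot mxE; under eq_bigr do rewrite mxE. Qed.

Lemma dot_continuous :
  continuous (fun p : 'rV[R]_n * 'rV[R]_n => dot p.1 p.2).
Proof.
under eq_fun do rewrite dotE.
apply: (@Ck_sum _ _ _ 0%N) => i p; apply: cvgM.
  apply: (@cvg_comp _ _ _ fst (fun q : 'rV[R]_n => q 0 i) _ (nbhs p.1)).
    exact: cvg_fst.
  exact: coord_continuous.
apply: (@cvg_comp _ _ _ snd (fun q : 'rV[R]_n => q 0 i) _ (nbhs p.2)).
  exact: cvg_snd.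
exact: coord_continuous.
Qed.

Lemma smooth_differentiable X x : smooth X -> differentiable X x.
Proof. by move=> /(_ 1%N)[]. Qed.

Lemma smooth_continuous X : smooth X -> continuous X.
Proof. exact: (fun sX => sX 0%N). Qed.

(** The derivative of [Y] in the varying direction [X] is the sum of the fixed
    partial derivatives of [Y], weighted by the coordinates of [X]; each term
    is then a product of smooth maps. *)
Lemma smooth_diff X Y : smooth X -> smooth Y -> smooth (fun x => 'd Y x (X x)).
Proof.
move=> sX sY k.
rewrite (_ : (fun _ => _) =
    fun x => \sum_(i < n) X x 0 i *: 'D_(delta_mx 0 i) Y x); last first.
  apply/funext => x; rewrite {1}(row_sum_delta (X x)) linear_sum /=.
  apply: eq_bigr => i _; rewrite linearZ deriveE //.
  exact: smooth_differentiable.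
apply: Ck_sum => i.
apply: (@Ck_bilinear _ _ _ _ _ *:%R) => [p||].
- by apply: cvgZ; [exact: cvg_fst|exact: cvg_snd].
- pose L := (fun M : 'rV[R]_n => M 0 i : R).
  have lL : linear L by move=> a u v; rewrite /L !mxE.
  pose LL : {linear _ -> _} := HB.pack L (GRing.isLinear.Build _ _ _ _ _ lL).
  have cL : continuous LL := @coord_continuous R 1 n 0 i.
  exact: (Ck_linear cL (sX k)).
- by have [_ DY] := sY k.+1; exact: DY.
Qed.

Lemma smooth_lie_bracket X Y : smooth X -> smooth Y -> smooth (lie_bracket X Y).
Proof.
move=> sX sY k; apply: Ck_add; first exact: smooth_diff.
apply: (@Ck_linear _ _ _ _ -%R); last exact: smooth_diff.
exact: opp_continuous.
Qed.

Lemma smooth_ad f s X : smooth f -> smooth X -> smooth (ad f s X).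
Proof.
by move=> sf sX; elim: s => //= s IHs; exact: smooth_lie_bracket.
Qed.

End VectorFields.

(** * The adjoint pairing along an extremal *)

Section Dynamics.
Context {R : realType} {n m : nat}.
Variables (f : 'rV[R]_n -> 'rV[R]_n) (g : 'I_m -> 'rV[R]_n -> 'rV[R]_n).
Hypotheses (f_smooth : smooth f) (g_smooth : forall i, smooth (g i)).
Implicit Types (u : 'rV[R]_m) (Y : 'rV[R]_n -> 'rV[R]_n).

(** Freezing the value [u] of the control turns the dynamics into a single
    vector field, so that the Hamiltonian becomes a plain pairing. *)
Definition controlled_field u (q : 'rV[R]_n) : 'rV[R]_n :=
  f q + \sum_i u 0 i *: g i q.

Lemma hamiltonianE lam q u :
  hamiltonian f g lam q u = dot lam (controlled_field u q).
Proof.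
rewrite /hamiltonian /controlled_field linearDr linear_sumr /=; congr (_ + _).
by apply: eq_bigr => i _; rewrite linearZr /= mulrC.
Qed.

Lemma differentiable_controlled_field u q :
  differentiable (controlled_field u) q.
Proof.
apply: differentiableD; first exact: smooth_differentiable.
have -> : (fun q => \sum_i u 0 i *: g i q) = \sum_i (u 0 i *: g i).
  by apply/funext => y; rewrite fct_sumE.
apply: differentiable_sum => i; apply: differentiableZ.
exact: smooth_differentiable.
Qed.

Lemma diff_controlled_field u q v :
  'd (controlled_field u) q v = 'd f q v + \sum_i u 0 i *: 'd (g i) q v.
Proof.
have Df : derivable f q v by apply/diff_derivable/smooth_differentiable.
have Dg i : derivable (g i) q v by apply/diff_derivable/smooth_differentiable.
have E : controlled_field u = f + \sum_i (u 0 i *: g i).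
  by apply/funext => y; rewrite /controlled_field /= fct_sumE.
transitivity ('D_v (controlled_field u) q).
  by apply/esym/deriveE; exact: differentiable_controlled_field.
have -> : 'D_v (controlled_field u) q =
    'D_v f q + \sum_i u 0 i *: 'D_v (g i) q.
  have dsum : is_derive q v (\sum_i (u 0 i *: g i))
      (\sum_i u 0 i *: 'D_v (g i) q).
    apply: (@is_derive_sum _ _ _ _ (fun i => u 0 i *: g i)) => i.
    exact: (is_deriveZ (u 0 i) (derivableP (Dg i))).
  rewrite E.
  have [_] := is_deriveD (derivableP Df) dsum.
  exact.
congr (_ + _); first exact: deriveE (smooth_differentiable q f_smooth).
apply: eq_bigr => i _; congr (_ *: _).
exact: deriveE (smooth_differentiable q (g_smooth i)).
Qed.

Lemma lie_bracket_controlled_field u Y q :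
  lie_bracket (controlled_field u) Y q =
  lie_bracket f Y q + \sum_i u 0 i *: lie_bracket (g i) Y q.
Proof.
have DYE : 'd Y q (controlled_field u q) =
    'd Y q (f q) + \sum_i u 0 i *: 'd Y q (g i q).
  rewrite [LHS]linearD [X in _ + X]linear_sum; congr (_ + _).
  by apply: eq_bigr => i _; exact: linearZ.
have regroup (a b : 'rV[R]_n) (A B : 'I_m -> 'rV[R]_n) :
    a + \sum_i u 0 i *: A i - (b + \sum_i u 0 i *: B i) =
    a - b + \sum_i u 0 i *: (A i - B i).
  rewrite opprD addrACA -sumrN -big_split /=; congr (_ + _).
  by apply: eq_bigr => i _; rewrite -scalerBr.
have DF := diff_controlled_field u q (Y q).
exact: etrans (congr2 (fun a b => a - b) DYE DF) (regroup _ _ _ _).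
Qed.

Lemma derive_dot (V : normedModType R) (F G : V -> 'rV[R]_n) x v :
  differentiable F x -> differentiable G x ->
  'D_v (fun y => dot (F y) (G y)) x =
  dot (F x) ('D_v G x) + dot ('D_v F x) (G x).
Proof.
by move=> dF dG; exact: (derive_bilinear (@dot_continuous R n) v dF dG).
Qed.

Lemma gradient_linear (w p : 'rV[R]_n) : gradient (fun p => dot p w) p = w.
Proof.
apply/rowP => i; rewrite mxE.
rewrite (derive_dot (F := id) (G := cst w)) //.
rewrite derive_cst derive_id linear0r add0r dotE (bigD1 i) //= big1 => [|j ji].
  by rewrite mxE !eqxx mul1r addr0.
by rewrite mxE eqxx (negPf ji) mul0r.
Qed.

Lemma dot_gradient (F : 'rV[R]_n -> 'rV[R]_n) lam q v :
  differentiable F q ->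
  dot (gradient (fun y => dot lam (F y)) q) v = dot lam ('d F q v).
Proof.
move=> dF; rewrite [in RHS](row_sum_delta v) linear_sum linear_sumr dotE /=.
apply: eq_bigr => i _; rewrite mxE linearZ linearZr /= mulrC; congr (_ * _).
rewrite (derive_dot (F := cst lam)) //.
by rewrite derive_cst linear0l addr0 deriveE.
Qed.

(** Differentiating the pairing gives the derivative of [Y] in the direction
    of the state velocity, minus, by the adjoint equation, the derivative of
    the frozen dynamics in the direction [Y]: their difference is exactly the
    Lie bracket. *)
Lemma derive_dot_field (x lam : R -> 'rV[R]_n) u Y (t : R) :
  smooth Y ->
  is_derive t 1 x (gradient (fun p => hamiltonian f g p (x t) u) (lam t)) ->
  is_derive t 1 lam (- gradient (fun q => hamiltonian f g (lam t) q u) (x t)) ->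
  'D_1 (fun r => dot (lam r) (Y (x r))) t =
  dot (lam t) (lie_bracket (controlled_field u) Y (x t)).
Proof.
move=> sY.
under eq_fun do rewrite hamiltonianE.
under [in X in _ -> X -> _]eq_fun do rewrite hamiltonianE.
rewrite gradient_linear.
move=> [/derivable1_diffP dx x'] [/derivable1_diffP dlam lam'].
have dY := smooth_differentiable (x t) sY.
have dYx : differentiable (Y \o x) t by exact: differentiable_comp.
rewrite (derive_dot (G := Y \o x)) //.
rewrite lam' (deriveE _ dYx) diff_comp //=.
have -> : 'd x t 1 = controlled_field u (x t).
  by rewrite -x'; apply/esym/deriveE.
rewrite linearNl /= dot_gradient; last exact: differentiable_controlled_field.
by rewrite /lie_bracket linearBr.
Qed.

End Dynamics.

(** * Absolutely continuous curves and almost everywhere identities *)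

Section AlmostEverywhere.
Context {R : realType}.

Lemma absolutely_continuous_uniform (V : normedModType R) (c d : R)
    (F : R -> V) :
  absolutely_continuous c d F -> forall e, 0 < e ->
  exists2 delta, 0 < delta & forall a b, c <= a -> a <= b -> b <= d ->
    b - a < delta -> `|F b - F a| < e.
Proof.
move=> acF e e0; have [delta delta0 small] := acF _ e0.
exists delta => // a b ca ab bd ba.
have := small 1%N (fun=> a) (fun=> b); rewrite !big_ord1; apply=> //.
by move=> i j _ _ _; rewrite !ord1.
Qed.

Lemma absolutely_continuous_cvg (V : normedModType R) (c d : R) (F : R -> V) t :
  absolutely_continuous c d F -> t \in `[c, d] ->
  F r @[r --> within `[c, d] (nbhs t)] --> F t.
Proof.
move=> acF td; apply/cvgrPdist_lt => e e0.
have [delta delta0 step] := absolutely_continuous_uniform acF e0.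
near=> r.
have rt : `|t - r| < delta by near: r; apply: cvg_within; exact: nbhsx_ballx.
have : r \in `[c, d] by near: r; exact: withinT.
move: td; rewrite !in_itv /= => /andP[ct td] /andP[cr rd].
have [tr|/ltW rt'] := leP t r.
  rewrite distrC; apply: step => //.
  by rewrite -(ger0_norm (_ : 0 <= r - t)) ?subr_ge0 // distrC.
by apply: step => //; rewrite -(ger0_norm (_ : 0 <= t - r)) ?subr_ge0.
Unshelve. all: by end_near. Qed.

(** If [h] were nonzero at a point of [[0, T]], it would be nonzero near it,
    hence on an open interval inside [[0, T]]; such an interval has positive
    measure, even when the point is one of the end points. *)
Lemma ae_zero_continuous (T : R) (h : R -> R) :
  0 < T ->
  (forall t, t \in `[0, T] -> h r @[r --> within `[0, T] (nbhs t)] --> h t) ->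
  {ae lebesgue_measure, forall t, t \in `]0, T[ -> h t = 0} ->
  forall t, t \in `[0, T] -> h t = 0.
Proof.
move=> T0 ch [N [mN N0 hN]] t tT; apply/eqP/negP => /negP ht0.
have : \forall r \near within `[0, T] (nbhs t), h r != 0.
  exact: (cvgr_neq0 _ (ch t tT) ht0).
rewrite near_withinE => /nbhs_ballP[e /= e0 he].
move: (tT); rewrite in_itv /= => /andP[t0 tT'].
pose a := Num.max 0 (t - e); pose b := Num.min T (t + e).
have ab : a < b.
  by rewrite gt_max !lt_min -andbA; apply/and4P; split; lra.
have abN : `]a, b[%classic `<=` N.
  move=> r; rewrite /= in_itv /= gt_max lt_min.
  move=> /andP[/andP[r0 tr] /andP[rT rt]].
  apply: hN => /= hr.
  have rN0 : h r != 0.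
    apply: he; last by rewrite /= in_itv /= !ltW.
    by rewrite /ball /= ltr_norml; apply/andP; split; lra.
  by move: rN0; rewrite hr ?eqxx // in_itv /= r0.
have : (lebesgue_measure `]a, b[%classic <= lebesgue_measure N)%E.
  by apply: le_measure => //; rewrite inE.
rewrite N0 lebesgue_measure_itv /= lte_fin ab -EFinB lee_fin.
by rewrite subr_le0 leNgt ab.
Qed.

(** The oscillation of the concatenation just after [T1] is small, and there it
    agrees with a shift of [q], which is close to its value at 0. *)
Lemma absolutely_continuous_concatenation (V : normedModType R) (T1 T2 : R)
    (p q : R -> V) :
  0 <= T1 -> 0 < T2 -> absolutely_continuous 0 T2 q ->
  absolutely_continuous 0 (T1 + T2) (concatenation T1 p q) -> p T1 = q 0.
Proof.
move=> T10 T20 acq acpq; apply/eqP; rewrite -subr_eq0 -normr_le0.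
apply/ler_addgt0Pl => e e0; rewrite addr0.
have e20 : 0 < e / 2 by rewrite divr_gt0.
have [d1 d10 step1] := absolutely_continuous_uniform acq e20.
have [d2 d20 step2] := absolutely_continuous_uniform acpq e20.
(* Halving makes [h] strictly smaller than both moduli. *)
pose h := Num.min T2 (Num.min d1 d2 / 2).
have h0 : 0 < h by rewrite lt_min T20 divr_gt0 // lt_min d10 d20.
have hT2 : h <= T2 by rewrite ge_min lexx.
have hd : h < Num.min d1 d2.
  rewrite gt_min; apply/orP; right.
  by rewrite ltr_pdivrMr // ltr_pMr ?lt_min ?d10 // ltr1n.
move: hd; rewrite lt_min => /andP[hd1 hd2].
have qh : `|q h - q 0| < e / 2 by apply: step1 => //; rewrite ?subr0 // ltW.
have : `|concatenation T1 p q (T1 + h) - concatenation T1 p q T1| < e / 2.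
  by apply: step2; lra.
rewrite /concatenation lexx gerDl leNgt h0 /= addrAC subrr add0r => pqh.
rewrite (splitr e) (le_trans (ler_distD (q h) _ _)) // lerD // ltW //.
by rewrite distrC.
Qed.

End AlmostEverywhere.

(** * What the costate of a singular arc annihilates *)

Section Annihilation.
Context {R : realType} {n m : nat}.
Variables (f : 'rV[R]_n -> 'rV[R]_n) (g : 'I_m -> 'rV[R]_n -> 'rV[R]_n).

Lemma dot_span (p : 'rV[R]_n) (ws : seq 'rV[R]_n) v :
  (forall w, w \in ws -> dot p w = 0) -> v \in <<ws>>%VS -> dot p v = 0.
Proof.
move=> pws vws; rewrite (coord_span (X := in_tuple ws) vws) linear_sumr /=.
apply: big1 => i _; rewrite linearZr /= pws ?scaler0 //.
exact: mem_nth.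
Qed.

Lemma dot_ad_span (J : nat -> {set 'I_m}) l p q v :
  (forall w j, (w < l)%N -> j \in J w -> dot p (ad f w (g j) q) = 0) ->
  v \in ad_span f g J l q -> dot p v = 0.
Proof.
move=> pJ; apply: dot_span => _ /allpairsPdep[w [j [wl jJ ->]]].
by apply: pJ; [move: wl; rewrite mem_iota | move: jJ; rewrite mem_enum].
Qed.

Hypotheses (f_smooth : smooth f) (g_smooth : forall i, smooth (g i)).

(** Induction on [l]. If [lam . ad_f^l g_j] vanishes identically, so does its
    derivative, which is
    [lam . ad_f^(l+1) g_j + sum_k u_k (lam . [g_k, ad_f^l g_j])] almost
    everywhere. The bracket condition for [j \in J (l+1)] puts each
    [[g_k, ad_f^l g_j]] in a span already annihilated by [lam], so only the
    first term remains; it is continuous, hence zero at every time. *)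
Lemma singular_arc_annihilates_ad (alpha beta : 'I_m -> R) T x lam u
    (S : {set 'I_m}) s J :
  0 < T -> extremal f g alpha beta T x lam u ->
  (forall i, i \in S -> singular g T x lam i) ->
  nested_from s S J -> bracket_condition f g s J T x ->
  forall l j, (l <= s)%N -> j \in J l ->
  forall t, t \in `[0, T] -> dot (lam t) (ad f l (g j) (x t)) = 0.
Proof.
move=> T0 [_ acx aclam _ [lam0 _ ae_ext]] sing [J0 Jsub _] brk l.
elim/ltn_ind: l => -[_ j _|l IHl j ls jJ]; first by rewrite J0 => /sing.
have sY := smooth_ad l f_smooth (g_smooth j).
have jJl : j \in J l by move/fintype.subsetP: (Jsub l ls); apply.
have h0 := IHl l (ltnSn l) j (ltnW ls) jJl.
apply: (ae_zero_continuous T0) => [t tT|].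
  have sadS := smooth_ad l.+1 f_smooth (g_smooth j).
  apply: (@continuous2_cvg _ _ _ _ _ _ lam (ad f l.+1 (g j) \o x) (@dot R n)).
  - exact: (@dot_continuous _ _ (lam t, ad f l.+1 (g j) (x t))).
  - exact: absolutely_continuous_cvg.
  - apply: cvg_comp; first exact: absolutely_continuous_cvg.
    exact: smooth_continuous.
have [N [mN N0 subN]] := ae_ext; exists N; split=> //.
apply: subset_trans subN; apply: subsetC => t /= ext t_oo.
have tT : t \in `[0, T] by apply: subset_itv_oo_cc.
have [x' lam' _ _] := ext tT.
have := derive_dot_field f_smooth g_smooth sY x' lam'.
(* [t] is interior to [0, T], so the pairing vanishes on a neighbourhood. *)
have -> : 'D_1 (fun r => dot (lam r) (ad f l (g j) (x r))) t = 0.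
  rewrite -(derive_cst (0 : R) t (1 : R)); apply: near_eq_derive.
  near=> r; apply: h0; apply: subset_itv_oo_cc; near: r.
  exact: near_in_itvoo.
rewrite (lie_bracket_controlled_field f_smooth g_smooth).
rewrite linearDr linear_sumr /= big1 ?addr0 // => k _.
rewrite linearZr /= (dot_ad_span (J := J) (l := l.+1) (q := x t)) ?scaler0 //.
  by move=> w i wl iJ; apply: IHl => //; exact: leq_trans (ltnW wl) ls.
exact: (brk t tT l.+1 _ j k jJ).
Unshelve. all: by end_near. Qed.

End Annihilation.
(** * The concatenation is not an extremal *)

Theorem proposition5 (R : realType) (n m : nat)
  (f : 'rV[R]_n -> 'rV[R]_n) (g : 'I_m -> 'rV[R]_n -> 'rV[R]_n)
  (f_smooth : smooth f) (g_smooth : forall i : 'I_m, smooth (g i))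
  (g_free : forall x : 'rV[R]_n, free [seq g i x | i <- enum 'I_m])
  (alpha beta : 'I_m -> R)
  (alpha_beta : forall i : 'I_m, alpha i < 0 < beta i)
  (S1 S2 : {set 'I_m})
  (S1_neq0 : S1 != finset.set0) (S2_neq0 : S2 != finset.set0)
  (T1 T2 : R) (T1_gt0 : 0 < T1) (T2_gt0 : 0 < T2)
  (x1 lam1 x2 lam2 : R -> 'rV[R]_n) (u1 u2 : R -> 'rV[R]_m)
  (extremal1 : extremal f g alpha beta T1 x1 lam1 u1)
  (extremal2 : extremal f g alpha beta T2 x2 lam2 u2)
  (singular1 : forall i : 'I_m, i \in S1 -> singular g T1 x1 lam1 i)
  (singular2 : forall i : 'I_m, i \in S2 -> singular g T2 x2 lam2 i)
  (junction : x1 T1 = x2 0)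
  (s : nat) (J1 J2 : nat -> {set 'I_m})
  (J1_nested : nested_from s S1 J1) (J2_nested : nested_from s S2 J2)
  (bracket1 : bracket_condition f g s J1 T1 x1)
  (bracket2 : bracket_condition f g s J2 T2 x2)
  (full_span :
    ad_span f g (fun w => J1 w :|: J2 w) s.+1 (x1 T1) = fullv) :
  ~ extremal f g alpha beta (T1 + T2)
      (concatenation T1 x1 x2) (concatenation T1 lam1 lam2)
      (concatenation T1 u1 u2).
Proof.
have ann1 := singular_arc_annihilates_ad f_smooth g_smooth T1_gt0 extremal1
  singular1 J1_nested bracket1.
have ann2 := singular_arc_annihilates_ad f_smooth g_smooth T2_gt0 extremal2
  singular2 J2_nested bracket2.
case=> _ _ ac_lam _ _.
have [_ _ ac_lam2 _ _] := extremal2; have [_ _ _ lam1_neq0 _] := extremal1.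
have lamE : lam1 T1 = lam2 0.
  exact: absolutely_continuous_concatenation (ltW T1_gt0) T2_gt0 ac_lam2 ac_lam.
have T1T1 : T1 \in `[0, T1] by rewrite in_itv /= lexx ltW.
have /eqP[] := lam1_neq0 T1 T1T1.
have lam_perp v : dot (lam1 T1) v = 0.
  apply: (dot_ad_span (f := f) (g := g) (q := x1 T1)
    (J := fun w => J1 w :|: J2 w) (l := s.+1)); last by rewrite full_span memvf.
  move=> w j; rewrite ltnS => ws /finset.setUP[jJ|jJ]; first exact: ann1.
  by rewrite junction lamE; apply: ann2; rewrite // in_itv /= lexx ltW.
apply/rowP => i; rewrite mxE -(lam_perp (delta_mx 0 i)) dotE (bigD1 i) //=.
rewrite big1 => [|k ki]; first by rewrite mxE !eqxx mulr1 addr0.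
by rewrite mxE eqxx (negPf ki) mulr0.
Qed.
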